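(* Let $X=\lambda_p(A,\mathbb{Z})$ be a Köthe sequence space, where $A=(a_{j,k})_{j\in\mathbb{Z},k\in\mathbb{N}}$ is a Köthe matrix on $\mathbb{Z}$ and $p\in\{0\}\cup[1,\infty)$. For each $k\in\mathbb{N}$, let $I_k=\{j\in\mathbb{Z}:a_{j,k}\ne0\}$. Let $w=(w_j)_{j\in\mathbb{Z}}$ be a sequence of nonzero scalars such that the bilateral weighted backward shift $B_w:(x_j)_{j\in\mathbb{Z}}\in X\mapsto(w_{j+1}x_{j+1})_{j\in\mathbb{Z}}\in X$ is an invertible operator on $X$. Then $B_w$ is uniformly expansive if and only if one of the following (mutually exclusive) properties holds: (a) For each $k\in\mathbb{N}$, there exists $\ell\in\mathbb{N}$ such that $$\lim_{n\to\infty}\Big(\inf_{j\in I_k}\frac{a_{j-n,\ell}\,|w_{j-n+1}\cdots w_j|}{a_{j,k}}\Big)=\infty.$$ (b) For each $k\in\mathbb{N}$, there exists $\ell\in\mathbb{N}$ such that $$\lim_{n\to\infty}\Big(\inf_{j\in I_k}\frac{a_{j+n,\ell}}{a_{j,k}\,|w_{j+1}\cdots w_{j+n}|}\Big)=\infty.$$ (c) For each $k\in\mathbb{N}$, there exists $\ell\in\mathbb{N}$ such that $$\lim_{n\to\infty}\Big(\inf_{j\in I_k\cap(-\mathbb{N})}\frac{a_{j-n,\ell}\,|w_{j-n+1}\cdots w_j|}{a_{j,k}}\Big)=\infty\quad\text{and}\quad\lim_{n\to\infty}\Big(\inf_{j\in I_k\cap\mathbb{N}}\frac{a_{j+n,\ell}}{a_{j,k}\,|w_{j+1}\cdots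 w_{j+n}|}\Big)=\infty.$$ Moreover, $B_w$ is uniformly positively expansive if and only if (a) holds.
   Context: $\mathbb{K}$ denotes $\mathbb{R}$ or $\mathbb{C}$, $\mathbb{N}=\{1,2,3,\dots\}$, and $-\mathbb{N}$ is the set of negative integers. The infimum of a family indexed by the empty set is $\infty$. An operator on a locally convex space $X$ is a continuous linear map $X\to X$; it is invertible if it has a continuous inverse, and $GL(X)$ is the set of invertible operators. A Köthe matrix on $\mathbb{Z}$ is a family of scalars $A=(a_{j,k})_{j\in\mathbb{Z},k\in\mathbb{N}}$ such that for each $j\in\mathbb{Z}$: $0\le a_{j,1}\le a_{j,2}\le\cdots$, and $a_{j,k}>0$ for some $k$. For $p\in[1,\infty)$, $\lambda_p(A,\mathbb{Z})=\{(x_j)\in\mathbb{K}^{\mathbb{Z}}:\sum_{j}|a_{j,k}x_j|^p<\infty\text{ for all }k\in\mathbb{N}\}$ with seminorms $\|x\|_k=(\sum_{j}|a_{j,k}x_j|^p)^{1/p}$. For $p=0$, $\lambda_0(A,\mathbb{Z})=\{(x_j)\in\mathbb{K}^{\mathbb{Z}}:\lim_{|j|\to\infty}a_{j,k}x_j=0\text{ for all }k\in\mathbb{N}\}$ with seminorms $\|x\|_k=\sup_{j}|a_{j,k}x_j|$. The space carries the Fréchet topology induced by the increasing sequence $(\|\cdot\|_k)_{k\in\mathbb{N}}$. Let $S_{\|\cdot\|_k}=\{x\in X:\|x\|_k=1\}$. Expressed with the seminorms $(\|\cdot\|_k)_{k\in\mathbb{N}}$: $T\in GL(X)$ is uniformly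 expansive if for each $k\in\mathbb{N}$ there exists $\ell\in\mathbb{N}$ such that one can write $S_{\|\cdot\|_k}=S_k^+\cup S_k^-$, where $\|T^nx\|_\ell\to\infty$ uniformly on $S_k^+$ as $n\to\infty$ and $\|T^{-n}x\|_\ell\to\infty$ uniformly on $S_k^-$ as $n\to\infty$. An operator $T$ on $X$ is uniformly positively expansive if for each $k\in\mathbb{N}$ there exists $\ell\in\mathbb{N}$ such that $\|T^nx\|_\ell\to\infty$ uniformly on $S_{\|\cdot\|_k}$ as $n\to\infty$. *)

(* Defs.v *)
From HB Require Import structures.
From mathcomp Require Import all_boot all_order all_algebra.
From mathcomp Require Import finmap complex.
From mathcomp Require Import all_classical all_reals all_analysis.
From mathcomp Require Import ring lra.

Set Implicit Arguments.
Unset Strict Implicit.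
Unset Printing Implicit Defensive.

Import Order.TTheory GRing.Theory Num.Theory.
Import numFieldNormedType.Exports.

Local Open Scope classical_set_scope.
Local Open Scope ring_scope.

Variant scalar_kind := RealScalars | ComplexScalars.

Definition base_field (R : realType) (F : scalar_kind) : numFieldType :=
  match F with RealScalars => R | ComplexScalars => R[i]%C end.

(* The norm of R[i] takes its values in R[i]; seminorms need an R-valued one. *)
Definition modulus (R : realType) (F : scalar_kind) : base_field R F -> R :=
  match F with
  | RealScalars => fun x : R => `|x|
  | ComplexScalars => fun z : R[i]%C => ComplexField.Normc.normc z
  end.

Section ModulusTheory.
Context (R : realType) (F : scalar_kind).
Implicit Types x y : base_field R F.

Lemma modulus_ge0 x : 0 <= modulus x.
Proof. by case: F x => [x|[a b]] /=; [exact: normr_ge0|exact: sqrtr_ge0]. Qed.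

Lemma modulus0 : modulus (0 : base_field R F) = 0.
Proof. by case: F => /=; [exact: normr0|exact: ComplexField.Normc.normc0]. Qed.

Lemma modulus1 : modulus (1 : base_field R F) = 1.
Proof. by case: F => /=; [exact: normr1|exact: ComplexField.Normc.normc1]. Qed.

Lemma modulusM x y : modulus (x * y) = modulus x * modulus y.
Proof.
by case: F x y => /= x y; [exact: normrM|exact: ComplexField.Normc.normcM].
Qed.

Lemma modulusD x y : modulus (x + y) <= modulus x + modulus y.
Proof. by case: F x y => /= x y; [exact: ler_normD|exact: le_normcD]. Qed.

Lemma modulus_convex x : 0 <= x -> x <= 1 -> modulus x + modulus (1 - x) = 1.
Proof.
case: F x => /= x.
  by move=> x0 x1; rewrite !ger0_norm ?subr_ge0// addrC subrK.
move=> x0 x1; apply: (@complexI R); rewrite rmorphD/= rmorph1.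
have E (z : R[i]%C) : (ComplexField.Normc.normc z)%:C%C = `|z| by [].
by rewrite !E !ger0_norm ?subr_ge0// addrC subrK.
Qed.

Lemma near_modulus (c : (base_field R F)^o) (e : R) : 0 < e ->
  \forall z \near c, modulus (z - c : base_field R F) < e.
Proof.
case: F c => /= c e0.
  apply: filterS (@nbhsx_ballx R R^o c _ e0) => z.
  by rewrite -ball_normE /= distrC.
have e0' : 0 < e%:C%C by rewrite ltcR.
apply: filterS (@nbhsx_ballx R[i]%C (R[i]%C)^o c _ e0') => z.
by rewrite -ball_normE /= distrC -ltcR.
Qed.

End ModulusTheory.

(* The index set {0} U [1, +oo[. *)
Variant exponent (R : realType) := ExpZero | ExpPow (p : R) of 1 <= p.
Arguments ExpZero {R}.

Section SequenceNorm.
Context (R : realType).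
Implicit Types (p : exponent R) (u v : int -> R).

(* Membership in c_0 or l_p, and the corresponding norm, of a sequence of
   nonnegative reals (the absolute values of a scalar sequence). *)
Definition seq_finite p u : Prop :=
  match p with
  | ExpZero => forall e, 0 < e ->
      exists N : nat, forall j : int, (N <= `|j|)%N -> u j < e
  | ExpPow p _ => (\esum_(j in [set: int]) (u j `^ p)%:E < +oo)%E
  end.

Definition seq_norm p u : R :=
  match p with
  | ExpZero => sup (range u)
  | ExpPow p _ => fine (\esum_(j in [set: int]) (u j `^ p)%:E) `^ p^-1
  end.

Let esum_leP (p : R) u (B : R) : 0 <= B ->
  (forall F : {fset int}, \sum_(j <- F) u j `^ p <= B) ->
  (\esum_(j in [set: int]) (u j `^ p)%:E <= B%:E)%E.
Proof.
move=> B0 H; apply: ge_ereal_sup => _ [X [finX _] <-].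
by rewrite fsbig_finite//= sumEFin lee_fin.
Qed.

Let leP_esum (p : R) u (B : R) :
  (\esum_(j in [set: int]) (u j `^ p)%:E <= B%:E)%E ->
  (forall F : {fset int}, \sum_(j <- F) u j `^ p <= B).
Proof.
move=> H F; rewrite -lee_fin -sumEFin; apply: le_trans H; apply: esum_ge.
exists [set` F]; first by split.
by rewrite fsbig_finite//= set_fsetK.
Qed.

Let esum_pow_ge0 (p : R) u : (0 <= \esum_(j in [set: int]) (u j `^ p)%:E)%E.
Proof. by apply: esum_ge0 => j _; rewrite lee_fin powR_ge0. Qed.

Let esum_fine (p : R) u : (\esum_(j in [set: int]) (u j `^ p)%:E < +oo)%E ->
  (\esum_(j in [set: int]) (u j `^ p)%:E)%E =
  (fine (\esum_(j in [set: int]) (u j `^ p)%:E))%:E.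
Proof. by move=> h; rewrite fineK// ge0_fin_numE// esum_pow_ge0. Qed.

Let norm_le (p : R) (p1 : 1 <= p) u (s : R) : 0 <= s ->
  (forall F : {fset int}, \sum_(j <- F) u j `^ p <= s `^ p) ->
  seq_finite (ExpPow p1) u /\ seq_norm (ExpPow p1) u <= s.
Proof.
move=> s0 /(esum_leP (powR_ge0 _ _)) h.
have fin : (\esum_(j in [set: int]) (u j `^ p)%:E < +oo)%E.
  by apply: le_lt_trans h _; rewrite ltry.
split=> //=; rewrite (esum_fine fin) lee_fin in h.
have p0 : 0 < p by rewrite (lt_le_trans _ p1).
have -> : s = (s `^ p) `^ p^-1.
  by rewrite -powRrM mulfV ?gt_eqF// powRr1.
apply: ge0_ler_powR => //; first by rewrite invr_ge0 ltW.
  by rewrite nnegrE fine_ge0// esum_pow_ge0.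
by rewrite nnegrE powR_ge0.
Qed.

Let le_norm (p : R) (p1 : 1 <= p) u (s : R) : seq_finite (ExpPow p1) u ->
  seq_norm (ExpPow p1) u <= s ->
  forall F : {fset int}, \sum_(j <- F) u j `^ p <= s `^ p.
Proof.
move=> /= fin h F.
have p0 : 0 < p by rewrite (lt_le_trans _ p1).
have := esum_fine fin; set S := fine _ => E.
have S0 : 0 <= S by rewrite fine_ge0// esum_pow_ge0.
apply: (@le_trans _ _ S).
  by apply: leP_esum; rewrite E.
have -> : S = (S `^ p^-1) `^ p.
  by rewrite -powRrM mulVf ?gt_eqF// powRr1.
apply: ge0_ler_powR => //; first exact: ltW.
  by rewrite nnegrE powR_ge0.
by rewrite nnegrE (le_trans _ h)// powR_ge0.
Qed.

Let seq_finite0_bounded u : (forall j, 0 <= u j) -> seq_finite ExpZero u ->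
  exists M, forall j, u j <= M.
Proof.
move=> u0 /(_ 1 ltr01) [N h].
exists (1 + \sum_(0 <= i < N) (u i%:Z + u (- i%:Z))) => j.
have [Nj|jN] := leqP N `|j|%N.
  apply: (le_trans (ltW (h j Nj))); rewrite lerDl sumr_ge0// => i _.
  by rewrite addr_ge0.
rewrite big_mkord (bigD1 (Ordinal jN))//=.
rewrite (@le_trans _ _ (u `|j|%N%:Z + u (- `|j|%N%:Z)))//; last first.
  rewrite addrCA lerDl addr_ge0// sumr_ge0// => i _.
  by rewrite addr_ge0.
by case: j {jN} => n /=; rewrite ?lerDl// NegzE lerDr.
Qed.

Let has_sup0 u : (forall j, 0 <= u j) -> seq_finite ExpZero u ->
  has_sup (range u).
Proof.
move=> u0 /(seq_finite0_bounded u0)[M h]; split; first by exists (u 0), 0.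
by exists M => _ [j _ <-].
Qed.

Lemma seq_norm_ge0 p u : (forall j, 0 <= u j) -> seq_finite p u ->
  0 <= seq_norm p u.
Proof.
case: p => [|p p1] u0 fin; last exact: powR_ge0.
by apply: (le_trans (u0 0)); apply: ub_le_sup; [case: (has_sup0 u0 fin)|exists 0].
Qed.

Lemma le_seq_norm p u v : (forall j, 0 <= u j) -> (forall j, u j <= v j) ->
  seq_finite p v -> seq_finite p u /\ seq_norm p u <= seq_norm p v.
Proof.
move=> u0 uv; have v0 j : 0 <= v j by exact: le_trans (uv j).
case: p => [|p p1] fin.
  split; first by move=> e /fin[N h]; exists N => j /h; exact: le_lt_trans.
  apply: ge_sup; first by exists (u 0), 0.
  move=> _ [j _ <-]; apply: (le_trans (uv j)).
  by apply: ub_le_sup; [case: (has_sup0 v0 fin)|exists j].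
apply: norm_le => [|F]; first exact: seq_norm_ge0.
apply: le_trans (le_norm fin (lexx _) F); apply: ler_sum => j _.
by rewrite ge0_ler_powR// ?nnegrE// (le_trans _ p1).
Qed.

Let minkowski_sum (p : R) (p1 : 1 <= p) u v (s t : R) (F : {fset int}) :
  (forall j, 0 <= u j) -> (forall j, 0 <= v j) -> 0 < s -> 0 < t ->
  \sum_(j <- F) u j `^ p <= s `^ p -> \sum_(j <- F) v j `^ p <= t `^ p ->
  \sum_(j <- F) (u j + v j) `^ p <= (s + t) `^ p.
Proof.
move=> u0 v0 s0 t0 Hs Ht.
have p0 : 0 < p by rewrite (lt_le_trans _ p1).
have st0 : 0 < s + t by rewrite addr_gt0.
have l0 : 0 <= s / (s + t) by rewrite divr_ge0// ltW.
have l1 : s / (s + t) <= 1 by rewrite ler_pdivrMr// mul1r lerDl ltW.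
have oml : 1 - s / (s + t) = t / (s + t).
  by rewrite -[X in X - _](@divff _ (s + t)) ?gt_eqF// -mulrBl addrC addKr.
apply: (@le_trans _ _ (\sum_(j <- F) (s + t) `^ p *
    (s / (s + t) * (u j `^ p / s `^ p) + t / (s + t) * (v j `^ p / t `^ p)))).
  apply: ler_sum => j _.
  have us : 0 <= u j / s by rewrite divr_ge0// ltW.
  have vt : 0 <= v j / t by rewrite divr_ge0// ltW.
  have := @convex_powR R p p1 (Itv01 l0 l1) (u j / s) (v j / t).
  rewrite !inE/= !in_itv/= !andbT => /(_ us vt).
  rewrite convRE [X in X `^ _ <= _]convRE /= /unstable.onem oml => H.
  have -> : u j + v j =
      (s + t) * (s / (s + t) * (u j / s) + t / (s + t) * (v j / t)).
    by field; rewrite !gt_eqF.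
  have E (x y : R) : 0 <= x -> 0 < y -> x `^ p / y `^ p = (x / y) `^ p.
    move=> x0 y0; rewrite powRM// ?invr_ge0 ?ltW//; congr (_ * _).
    by rewrite -(powR_inv1 (ltW y0)) -powRrM mulrC powRrM powR_inv1 ?powR_ge0.
  rewrite powRM ?(ltW st0)//; last by rewrite addr_ge0// mulr_ge0// divr_ge0// ltW.
  by rewrite !E// ler_wpM2l ?powR_ge0.
rewrite -mulr_sumr big_split/= -!mulr_sumr -!mulr_suml.
rewrite -[leRHS]mulr1 ler_wpM2l ?powR_ge0//.
rewrite -[leRHS](subrKC (s / (s + t))) oml lerD//.
  by rewrite ler_piMr// ler_pdivrMr ?powR_gt0// mul1r.
rewrite ler_piMr//; first by rewrite divr_ge0// ltW.
by rewrite ler_pdivrMr ?powR_gt0// mul1r.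
Qed.

Lemma seq_normD p u v : (forall j, 0 <= u j) -> (forall j, 0 <= v j) ->
  seq_finite p u -> seq_finite p v ->
  seq_finite p (fun j => u j + v j) /\
  seq_norm p (fun j => u j + v j) <= seq_norm p u + seq_norm p v.
Proof.
move=> u0 v0; case: p => [|p p1] finu finv.
  split.
    move=> e e0; have e20 : 0 < e / 2 by rewrite divr_gt0.
    have [N1 h1] := finu _ e20; have [N2 h2] := finv _ e20.
    exists (maxn N1 N2) => j; rewrite geq_max => /andP[/h1 + /h2]; lra.
  apply: ge_sup; first by exists (u 0 + v 0), 0.
  move=> _ [j _ <-]; apply: lerD; apply: ub_le_sup; try by exists j.
    by case: (has_sup0 u0 finu).
  by case: (has_sup0 v0 finv).
have p0 : 0 < p by rewrite (lt_le_trans _ p1).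
have nu := seq_norm_ge0 u0 finu; have nv := seq_norm_ge0 v0 finv.
have lu := le_norm finu (lexx _); have lv := le_norm finv (lexx _).
move: (seq_norm _ u) (seq_norm _ v) nu nv lu lv => a b a0 b0 lu lv.
have H e : 0 < e -> seq_finite (ExpPow p1) (fun j => u j + v j) /\
    seq_norm (ExpPow p1) (fun j => u j + v j) <= a + b + e.
  move=> e0; have e2 : 0 < e / 2 by rewrite divr_gt0.
  apply: norm_le => [|F]; first by rewrite !addr_ge0// ltW.
  have -> : a + b + e = (a + e / 2) + (b + e / 2) by field.
  apply: minkowski_sum; rewrite ?ltr_wpDl//.
    by apply: le_trans (lu F) _; rewrite ge0_ler_powR ?nnegrE ?addr_ge0 ?lerDl ?(ltW p0) ?(ltW e2)//.
  by apply: le_trans (lv F) _; rewrite ge0_ler_powR ?nnegrE ?addr_ge0 ?lerDl ?(ltW p0) ?(ltW e2)//.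
split; first by case: (H 1 ltr01).
by apply/ler_addgt0Pr => e /H[].
Qed.

Lemma seq_normZ p (c : R) u : 0 <= c -> (forall j, 0 <= u j) ->
  seq_finite p u ->
  seq_finite p (fun j => c * u j) /\
  seq_norm p (fun j => c * u j) <= c * seq_norm p u.
Proof.
move=> c0 u0; case: p => [|p p1] fin.
  split.
    move=> e e0; have c1 : 0 < c + 1 by rewrite ltr_wpDl.
    have [N h] := fin (e / (c + 1)) (divr_gt0 e0 c1).
    exists N => j /h; rewrite ltr_pdivlMr// mulrC; apply: le_lt_trans.
    by rewrite ler_wpM2r// lerDl.
  apply: ge_sup; first by exists (c * u 0), 0.
  move=> _ [j _ <-]; apply: ler_wpM2l => //.
  by apply: ub_le_sup; [case: (has_sup0 u0 fin)|exists j].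
have p0 : 0 < p by rewrite (lt_le_trans _ p1).
have nu := seq_norm_ge0 u0 fin.
apply: norm_le => [|F]; first by rewrite mulr_ge0.
rewrite powRM// (eq_bigr (fun j => c `^ p * u j `^ p)); last first.
  by move=> j _; rewrite powRM.
by rewrite -mulr_sumr ler_wpM2l ?powR_ge0//; exact: le_norm.
Qed.

Lemma seq_finite_0 p : seq_finite p (cst 0 : int -> R).
Proof.
case: p => [|q q1] /=; first by move=> e e0; exists 0%N.
rewrite esum1 ?ltry// => j _; rewrite powR0// gt_eqF//.
by rewrite (lt_le_trans _ q1).
Qed.

Lemma seq_norm_0 p : seq_norm p (cst 0 : int -> R) = 0.
Proof.
case: p => [|q q1] /=.
  rewrite (_ : range _ = [set 0]) ?sup1//.
  by apply/seteqP; split=> [_ [j _ <-]//|_ ->]; exists 0.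
have q0 : 0 < q by rewrite (lt_le_trans _ q1).
rewrite esum1; first by rewrite powR0// invr_neq0// gt_eqF.
by move=> j _; rewrite powR0// gt_eqF.
Qed.

End SequenceNorm.

(* Only the order of the second index matters, so it runs over {0, 1, ...}
   instead of {1, 2, ...}. *)
Record kothe_matrix (R : realType) := KotheMatrix {
  kothe_entry :> int -> nat -> R;
  kothe_entry_ge0 : forall j k, 0 <= kothe_entry j k;
  kothe_entry_nondecreasing : forall j k,
    kothe_entry j k <= kothe_entry j k.+1;
  kothe_entry_gt0 : forall j, exists k, 0 < kothe_entry j k }.

Section KotheSpace.
Context (R : realType) (F : scalar_kind) (p : exponent R) (A : kothe_matrix R).

Local Opaque seq_finite seq_norm.

Definition kothe_pred : {pred int -> (base_field R F)^o} :=
  [pred x | `[< forall k, seq_finite p (fun j => A j k * modulus (x j)) >]].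

Record kothe_space := Kothe {
  kothe_seq :> int -> (base_field R F)^o;
  _ : kothe_seq \in kothe_pred }.

HB.instance Definition _ := [isSub for kothe_seq].
HB.instance Definition _ := [Choice of kothe_space by <:].

Let weight_ge0 k (x : int -> (base_field R F)^o) j : 0 <= A j k * modulus (x j).
Proof. by rewrite mulr_ge0 ?kothe_entry_ge0 ?modulus_ge0. Qed.

Let kothe_combine (c : base_field R F) (x y : int -> (base_field R F)^o) k :
  seq_finite p (fun j => A j k * modulus (x j)) ->
  seq_finite p (fun j => A j k * modulus (y j)) ->
  seq_finite p (fun j => A j k * modulus ((c *: x + y) j)) /\
  seq_norm p (fun j => A j k * modulus ((c *: x + y) j)) <=
    modulus c * seq_norm p (fun j => A j k * modulus (x j)) +
    seq_norm p (fun j => A j k * modulus (y j)).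
Proof.
move=> fx fy.
have [fcx ncx] := seq_normZ (modulus_ge0 c) (weight_ge0 k x) fx.
have cx0 j : 0 <= modulus c * (A j k * modulus (x j)).
  by rewrite mulr_ge0 ?modulus_ge0.
have [fs ns] := seq_normD cx0 (weight_ge0 k y) fcx fy.
have H j : A j k * modulus ((c *: x + y) j) <=
    modulus c * (A j k * modulus (x j)) + A j k * modulus (y j).
  rewrite mulrCA -mulrDr ler_wpM2l ?kothe_entry_ge0//.
  by rewrite -modulusM; exact: modulusD.
have [f n] := le_seq_norm (weight_ge0 k (c *: x + y)) H fs.
split; first exact: f.
apply: (le_trans n).
apply: (le_trans ns).
rewrite lerD2r.
exact: ncx.
Qed.

Let seq_finite0 k : seq_finite p
  (fun j => A j k * modulus ((0 : int -> (base_field R F)^o) j)).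
Proof.
have -> : (fun j => A j k * modulus ((0 : int -> (base_field R F)^o) j)) = cst 0.
  by apply/funext => j /=; rewrite modulus0 mulr0.
exact: seq_finite_0.
Qed.

Fact kothe_submod_closed : GRing.submod_closed kothe_pred.
Proof.
split; first by apply/asboolP => k; exact: seq_finite0.
move=> c x y /asboolP fx /asboolP fy; apply/asboolP => k.
by case: (kothe_combine c (fx k) (fy k)).
Qed.

HB.instance Definition _ := GRing.isSubmodClosed.Build (base_field R F)
  (int -> (base_field R F)^o) kothe_pred kothe_submod_closed.
HB.instance Definition _ := [SubChoice_isSubLmodule of kothe_space by <:].

Implicit Types x y : kothe_space.

Definition kothe_seminorm (k : nat) x : R :=
  seq_norm p (fun j => A j k * modulus (x j)).

Let fin x k : seq_finite p (fun j => A j k * modulus (x j)).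
Proof. by case: x => x /= /asboolP. Qed.

Lemma kothe_seminorm_ge0 k x : 0 <= kothe_seminorm k x.
Proof. exact: seq_norm_ge0. Qed.

Lemma kothe_seminorm_linear k c x y : kothe_seminorm k (c *: x + y) <=
  modulus c * kothe_seminorm k x + kothe_seminorm k y.
Proof. by case: (kothe_combine c (fin x k) (fin y k)). Qed.

Lemma kothe_seminorm0 k : kothe_seminorm k 0 = 0.
Proof.
rewrite /kothe_seminorm -[RHS](seq_norm_0 p); congr (seq_norm _ _).
by apply/funext => j /=; rewrite modulus0 mulr0.
Qed.

Lemma kothe_seminormZ k c x :
  kothe_seminorm k (c *: x) <= modulus c * kothe_seminorm k x.
Proof.
by have := kothe_seminorm_linear k c x 0; rewrite kothe_seminorm0 !addr0.
Qed.

Lemma kothe_seminormD k x y :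
  kothe_seminorm k (x + y) <= kothe_seminorm k x + kothe_seminorm k y.
Proof.
by have := kothe_seminorm_linear k 1 x y; rewrite scale1r modulus1 mul1r.
Qed.

Lemma le_kothe_seminorm k l x : (k <= l)%N ->
  kothe_seminorm k x <= kothe_seminorm l x.
Proof.
move=> kl; case: (le_seq_norm (weight_ge0 k x) _ (fin x l)) => // j.
rewrite ler_wpM2r ?modulus_ge0//.
elim: l kl => [|l IH]; first by rewrite leqn0 => /eqP ->.
rewrite leq_eqVlt => /predU1P[-> //|]; rewrite ltnS => /IH /le_trans; apply.
exact: kothe_entry_nondecreasing.
Qed.

Definition kothe_ball k x (e : R) : set kothe_space :=
  [set y | kothe_seminorm k (y - x) < e].

(* The locally convex topology induced by the seminorms. As they increase with
   k, the balls of a single seminorm already form a basis of neighborhoods. *)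
Definition kothe_nbhs x : set_system kothe_space :=
  [set U | exists k e, 0 < e /\ kothe_ball k x e `<=` U].

HB.instance Definition _ := hasNbhs.Build kothe_space kothe_nbhs.

Lemma kothe_nbhsE x U :
  nbhs x U <-> exists k e, 0 < e /\ kothe_ball k x e `<=` U.
Proof. by []. Qed.

Lemma kothe_ball_center k x e : 0 < e -> kothe_ball k x e x.
Proof. by rewrite /kothe_ball/= subrr kothe_seminorm0. Qed.

Lemma kothe_ball_nbhs k x e : 0 < e -> nbhs x (kothe_ball k x e).
Proof. by move=> e0; exists k, e; split=> [//|y]. Qed.

Lemma kothe_ball_triangle k x y e z : kothe_ball k x e y ->
  kothe_ball k y (e - kothe_seminorm k (y - x)) z -> kothe_ball k x e z.
Proof.
move=> _.
rewrite /kothe_ball.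
rewrite mksetE.
rewrite mksetE.
move=> zy.
have -> : z - x = (z - y) + (y - x).
  by rewrite addrA subrK.
apply: le_lt_trans (kothe_seminormD _ _ _) _.
by rewrite -ltrBrDr.
Qed.

Let kothe_nbhs_filter x : ProperFilter (kothe_nbhs x).
Proof.
split; first by move=> [k [e [e0]]] /(_ x) /(_ (kothe_ball_center k x e0)).
split; first by exists 0%N, 1.
  move=> U V [k [e [e0 kU]]] [l [d [d0 lV]]].
  exists (maxn k l), (Num.min e d); split; first by rewrite lt_min e0.
  move=> y; rewrite /kothe_ball/= lt_min => /andP[ye yd].
  split; [apply: kU|apply: lV].
    exact: le_lt_trans (le_kothe_seminorm _ (leq_maxl _ _)) ye.
  exact: le_lt_trans (le_kothe_seminorm _ (leq_maxr _ _)) yd.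
by move=> U V UV [k [e [e0 kU]]]; exists k, e; split=> // y /kU /UV.
Qed.

Let kothe_nbhs_singleton x (U : set kothe_space) : kothe_nbhs x U -> U x.
Proof. by move=> [k [e [e0]]]; apply; exact: kothe_ball_center. Qed.

Let kothe_nbhs_nbhs x (U : set kothe_space) :
  kothe_nbhs x U -> kothe_nbhs x (kothe_nbhs^~ U).
Proof.
move=> [k [e [e0 kU]]]; exists k, e; split=> // y xy.
exists k, (e - kothe_seminorm k (y - x)); split; first by rewrite subr_gt0.
by move=> z /(kothe_ball_triangle xy) /kU.
Qed.

HB.instance Definition _ := Nbhs_isNbhsTopological.Build kothe_space
  kothe_nbhs_filter kothe_nbhs_singleton kothe_nbhs_nbhs.

Let kothe_add_continuous :
  continuous (fun xy : kothe_space * kothe_space => xy.1 + xy.2).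
Proof.
move=> [x y] U /= /kothe_nbhsE[k [e [e0 kU]]].
have e20 : 0 < e / 2 by rewrite divr_gt0.
exists (kothe_ball k x (e / 2), kothe_ball k y (e / 2)).
  by split; exact: kothe_ball_nbhs.
move=> [z t] [/= zx ty]; apply: kU; rewrite /kothe_ball/=.
rewrite opprD addrACA (le_lt_trans (kothe_seminormD _ _ _))//.
rewrite (splitr e); exact: ltrD zx ty.
Qed.

Let kothe_scale_continuous :
  continuous (fun cx : (base_field R F)^o * kothe_space => cx.1 *: cx.2).
Proof.
move=> [c x] U /= /kothe_nbhsE[k [e [e0 kU]]].
have nx0 := kothe_seminorm_ge0 k x; have mc0 := modulus_ge0 (c : base_field R F).
set q := kothe_seminorm k x in nx0 *; set m := modulus _ in mc0 *.
have d0 : 0 < Num.min 1 (e / 2 / (q + 1)).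
  by rewrite lt_min ltr01 !divr_gt0// ltr_wpDl.
have r0 : 0 < e / 2 / (m + 1) by rewrite !divr_gt0// ltr_wpDl.
exists ([set z : (base_field R F)^o | modulus (z - c : base_field R F) <
    Num.min 1 (e / 2 / (q + 1))], kothe_ball k x (e / 2 / (m + 1))).
  by split; [exact: near_modulus|exact: kothe_ball_nbhs].
move=> [z y] [/= + yx]; rewrite lt_min => /andP[z1 z2].
apply: kU; rewrite /kothe_ball/=.
have -> : z *: y - c *: x = z *: (y - x) + (z - c) *: x.
  by rewrite scalerBr scalerBl addrA subrK.
apply: le_lt_trans (kothe_seminorm_linear _ _ _ _) _.
have H1 : kothe_seminorm k ((z - c) *: x) <= e / 2 / (q + 1) * q.
  apply: le_trans (kothe_seminormZ _ _ _) _.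
  by rewrite ler_wpM2r// ltW.
have H2 : e / 2 / (q + 1) * q <= e / 2.
  by rewrite mulrAC ler_pdivrMr ?ltr_wpDl// ler_wpM2l ?divr_ge0 ?lerDl// ltW.
have zm : modulus (z : base_field R F) <= m + 1.
  rewrite -[z](subrK c) addrC (le_trans (modulusD _ _))//.
  by rewrite lerD2l ltW.
have H3 : modulus (z : base_field R F) * kothe_seminorm k (y - x) < e / 2.
  apply: (@le_lt_trans _ _ ((m + 1) * kothe_seminorm k (y - x))).
    exact: (ler_wpM2r (kothe_seminorm_ge0 _ _) zm).
  have m10 : 0 < m + 1 by rewrite ltr_wpDl.
  rewrite mulrC -(ltr_pdivlMr _ _ m10); exact: yx.
rewrite (splitr e); apply: ltr_leD H3 _.
exact: le_trans H1 H2.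
Qed.

Let kothe_locally_convex : exists2 B : set_system kothe_space,
  (forall b, b \in B -> convex_set b) & basis B.
Proof.
exists [set U | exists k x e, U = kothe_ball k x e].
  move=> U /set_mem[k [x [e ->]]] y z t /set_mem yx /set_mem zx.
  apply/mem_set.
  have c0 : 0 <= t%:num by exact: ge0.
  have c1 : t%:num <= 1 by exact: le1.
  have := modulus_convex c0 c1; set c : base_field R F := t%:num => mc.
  rewrite /kothe_ball mksetE.
  have -> : conv t y z - x = c *: (y - x) + (1 - c) *: (z - x).
    rewrite !scalerBr addrACA -opprD -scalerDl subrKC scale1r.
    by [].
  apply: le_lt_trans (kothe_seminorm_linear _ _ _ _) _.
  apply: (@le_lt_trans _ _ (modulus c * kothe_seminorm k (y - x) +
      modulus (1 - c) * kothe_seminorm k (z - x))).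
    by rewrite lerD2l; exact: kothe_seminormZ.
  move: yx zx; rewrite /kothe_ball !mksetE.
  have := modulus_ge0 c; have := modulus_ge0 (1 - c).
  move: (kothe_seminorm k (y - x)) (kothe_seminorm k (z - x)).
  move: (modulus c) (modulus (1 - c)) mc.
  clear => r s rs a b s0 r0 ae be.
  have -> : e = r * e + s * e by rewrite -mulrDl rs mul1r.
  have [r_gt0|r_le0] := ltP 0 r.
    by rewrite ltr_leD// ?ltr_pM2l// ler_wpM2l// ltW.
  have r_eq0 : r = 0 by apply/eqP; rewrite eq_le r_le0.
  by move: rs; rewrite r_eq0 add0r => ->; rewrite !mul0r !mul1r !add0r.
split=> [_ [k [x [e ->]]]|x U [k [e [e0 kU]]]].
  rewrite openE => y xy; exists k, (e - kothe_seminorm k (y - x)).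
  split; first by rewrite subr_gt0.
  by move=> z; exact: kothe_ball_triangle.
exists (kothe_ball k x e) => //; split; last exact: kothe_ball_center.
by exists k, x, e.
Qed.

HB.instance Definition _ := PreTopologicalLmod_isTvs.Build (base_field R F)
  kothe_space kothe_add_continuous kothe_scale_continuous kothe_locally_convex.
(* The previous factory only derives the uniform structure. *)
HB.instance Definition _ :=
  PreTopologicalNmodule_isTopologicalNmodule.Build kothe_space
    kothe_add_continuous.
HB.instance Definition _ :=
  TopologicalNmodule_isTopologicalLmodule.Build (base_field R F) kothe_space
    kothe_scale_continuous.
HB.instance Definition _ :=
  Uniform_isTvs.Build (base_field R F) kothe_space kothe_locally_convex.

End KotheSpace.

Record operator (K : numDomainType) (X : tvsType K) := Operator {
  op_fun :> {linear X -> X};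
  op_continuous : continuous op_fun }.

Record GL (K : numDomainType) (X : tvsType K) := InvertibleOperator {
  GL_op :> operator X;
  GL_inv : operator X;
  GL_opK : cancel GL_op GL_inv;
  GL_invK : cancel GL_inv GL_op }.

Section Expansivity.
Context (R : realType) (K : numDomainType) (X : tvsType K).
Variable q : nat -> X -> R.

Definition unit_sphere (k : nat) : set X := [set x | q k x = 1].

Definition diverges_uniformly_on (S : set X) (f : nat -> X -> R) : Prop :=
  forall M : R, \forall n \near \oo, forall x, S x -> M <= f n x.

Definition uniformly_expansive (T : GL X) : Prop :=
  forall k, exists l, exists Sp Sm : set X,
    [/\ unit_sphere k = Sp `|` Sm,
        diverges_uniformly_on Sp (fun n x => q l (iter n T x)) &
        diverges_uniformly_on Sm (fun n x => q l (iter n (GL_inv T) x))].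

Definition uniformly_positively_expansive (T : operator X) : Prop :=
  forall k, exists l,
    diverges_uniformly_on (unit_sphere k) (fun n x => q l (iter n T x)).

End Expansivity.

Section WeightedShift.
Context (R : realType) (F : scalar_kind).
Variables (A : kothe_matrix R) (w : int -> base_field R F).

Definition weighted_backward_shift (x : int -> base_field R F) :
    int -> base_field R F :=
  fun j => w (j + 1) * x (j + 1).

Definition kothe_support (k : nat) : set int := [set j | A j k != 0].

(* a_(j-n,l) |w_(j-n+1) ... w_j| / a_(j,k) *)
Definition backward_ratio (k l n : nat) (j : int) : R :=
  A (j - n%:Z) l * modulus (\prod_(1 <= i < n.+1) w (j - n%:Z + i%:Z)) / A j k.

(* a_(j+n,l) / (a_(j,k) |w_(j+1) ... w_(j+n)|) *)
Definition forward_ratio (k l n : nat) (j : int) : R :=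
  A (j + n%:Z) l / (A j k * modulus (\prod_(1 <= i < n.+1) w (j + i%:Z))).

Definition inf_diverges (I : set int) (r : nat -> int -> R) : Prop :=
  (fun n => ereal_inf [set (r n j)%:E | j in I]) @ \oo --> (+oo)%E.

Definition backward_condition : Prop := forall k, exists l,
  inf_diverges (kothe_support k) (backward_ratio k l).

Definition forward_condition : Prop := forall k, exists l,
  inf_diverges (kothe_support k) (forward_ratio k l).

Definition split_condition : Prop := forall k, exists l,
  inf_diverges (kothe_support k `&` [set j | j < 0]) (backward_ratio k l) /\
  inf_diverges (kothe_support k `&` [set j | 0 < j]) (forward_ratio k l).

End WeightedShift.

(* Main.v *)
Require Import Defs.
From mathcomp Require Import all_boot all_order all_algebra.
From mathcomp Require Import all_classical all_reals all_analysis.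
From mathcomp Require Import zify ring lra complex.

Set Implicit Arguments.
Unset Strict Implicit.
Unset Printing Implicit Defensive.

Import Order.TTheory GRing.Theory Num.Theory.
Import numFieldNormedType.Exports.

Local Open Scope ring_scope.

(** A weighted shift is a plain translation in disguise. Pick positive reals
c_j with c_(j-1) = c_j |w_j|; then x |-> (x_j / c_j)_j conjugates B_w, up to
phases that no seminorm sees, to the unweighted backward shift on the Koethe
space of the matrix B_(j,k) = c_j a_(j,k) ([scale], [rescaled]), and the two
ratios of the statement become B_(j-n,l) / B_(j,k) and B_(j+n,l) / B_(j,k).
Everything below is about the matrix B, with the direction of motion recorded
by a sign s: s = -1 for B_w and s = 1 for its inverse.

From operators to matrices. If all the ratios over a set J of indices exceed M,
then moving n steps in direction s multiplies the part of x carried by J by at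
least M ([part_seminorm_expands]); conversely, normalized unit vectors see the
ratios themselves ([unit_vector_orbit]). Since on the unit sphere either the
part of x on J or the part off J has seminorm at least 1/2, uniform expansivity
amounts to the existence, for each k, of l and of a set J of indices such that
the backward ratios diverge uniformly on J and the forward ones uniformly off
J ([uniformly_expansiveP]). Uniform positive expansivity is the case where J is
everything ([uniformly_positively_expansiveP]).

Classification of the sets J. Let B_(j,l) tend to infinity along the half-line
in direction s; this is what divergence at a single index gives, whatever the
index ([escapes_of_diverges]). If this fails for all l in one direction, nothing
can move that way, so that all the indices of the support of B_(.,k) move the
other way: this is (a) or (b) ([splits_oriented]). Otherwise it holds in both
directions for large l. Then an index j far out on the side opposite to s cannot
belong to a set on which the ratios in direction s diverge uniformly: after |j|
steps it would sit at 0, so that B_(j,k) <= B_(0,l), whereas B_(j,k) is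
arbitrarily large ([diverges_bounded]). So, on the support of B_(.,k), J agrees
with the negative indices up to a finite set, which is harmless
([diverges_finite]), and (c) follows
([diverges_half], [splitsP]). The same observation makes (a), (b) and (c)
mutually exclusive ([oriented_not_escapes]). *)

(** * Uniform growth along translations of the integers *)

Section Growth.
Local Open Scope classical_set_scope.
Context (R : realType) (B : kothe_matrix R).
Implicit Types (s j : int) (J : set int) (k l : nat) (M : R).

(** The bound M <= B_(j + s n,l) / B_(j,k), multiplied out so that it holds
trivially where B_(j,k) vanishes: the infima that define the three conditions
run over the support of B_(.,k) only. *)
Definition diverges s J k l : Prop :=
  forall M, \forall n \near \oo,
    forall j, J j -> M * B j k <= B (j + s * n%:Z) l.

Definition escapes s l : Prop :=
  forall M, exists N : int, forall j, N <= s * j -> M <= B j l.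

(** Conditions (a) and (b), for s = -1 and s = 1. *)
Definition oriented s : Prop := forall k, exists l, diverges s setT k l.

(** Condition (c): each half-line moves away from the origin. *)
Definition outward : Prop := forall k, exists l,
  diverges (-1) [set j | j < 0] k l /\ diverges 1 [set j | 0 < j] k l.

(** What uniform expansivity says about unit vectors. *)
Definition splits : Prop := forall k, exists l J,
  diverges (-1) J k l /\ diverges 1 (~` J) k l.

Lemma le_kothe_entry j k l : (k <= l)%N -> B j k <= B j l.
Proof.
elim: l => [|l IH]; first by rewrite leqn0 => /eqP ->.
rewrite leq_eqVlt => /predU1P[-> //|]; rewrite ltnS => /IH /le_trans; apply.
exact: kothe_entry_nondecreasing.
Qed.

(** The required inequality gets stronger as M grows. *)
Lemma divergesP s J k l :
  (forall M, 0 < M -> \forall n \near \oo,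
     forall j, J j -> M * B j k <= B (j + s * n%:Z) l) -> diverges s J k l.
Proof.
move=> H M; have M0 : 0 < Num.max 1 M by rewrite lt_max ltr01.
apply: filterS (H _ M0) => n Hn j /Hn; apply: le_trans.
by rewrite ler_wpM2r ?kothe_entry_ge0// le_max lexx orbT.
Qed.

Lemma diverges_le s J k k' l l' : (k <= k')%N -> (l' <= l)%N ->
  diverges s J k' l' -> diverges s J k l.
Proof.
move=> kk' ll' H; apply: divergesP => M M0.
apply: filterS (H M) => n Hn j /Hn h.
apply: le_trans (le_kothe_entry _ ll'); apply: le_trans h.
by rewrite ler_wpM2l ?(ltW M0)// le_kothe_entry.
Qed.

Lemma divergesS s J J' k l : J `<=` J' -> diverges s J' k l -> diverges s J k l.
Proof. by move=> JJ' H M; apply: filterS (H M) => n Hn j /JJ' /Hn. Qed.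

Lemma divergesU s J J' k l :
  diverges s J k l -> diverges s J' k l -> diverges s (J `|` J') k l.
Proof.
move=> H H' M; apply: filterS2 (H M) (H' M) => n Hn Hn' j [].
  exact: Hn.
exact: Hn'.
Qed.

Lemma diverges_null s J k l : (forall j, J j -> B j k = 0) -> diverges s J k l.
Proof.
by move=> H M; exists 0%N => // n _ j /H ->; rewrite mulr0 kothe_entry_ge0.
Qed.

Lemma escapes_le s k l : (k <= l)%N -> escapes s k -> escapes s l.
Proof.
move=> kl H M; have [N HN] := H M; exists N => j /HN h.
exact: le_trans h (le_kothe_entry _ kl).
Qed.

(** The translates of a single index j0 sweep the whole half-line beyond j0. *)
Lemma escapes_of_diverges s J k l j0 : s * s = 1 -> J j0 -> 0 < B j0 k ->
  diverges s J k l -> escapes s l.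
Proof.
move=> ss Jj0 B0 H M; have [N _ HN] := H (M / B j0 k).
exists (N%:Z + s * j0) => j Nj.
pose n := `|(s * j - s * j0)%R|%N.
have nE : n%:Z = s * j - s * j0 by rewrite /n; lia.
have := HN n _ j0 Jj0; rewrite /= divfK ?gt_eqF// nE.
rewrite mulrBr !mulrA ss !mul1r addrC subrK; apply.
by rewrite -lez_nat nE; lia.
Qed.

(** On a finite set of indices B_(j,k) is bounded, and a translate of the set
eventually enters the region where B_(.,l) is as large as wanted. *)
Lemma diverges_finite s J k l (N : nat) : s * s = 1 ->
  (forall j, J j -> (`|j| <= N)%N) -> escapes s l -> diverges s J k l.
Proof.
move=> ss JN H; apply: divergesP => M M0.
have [C HC] : exists C, forall j, (`|j| <= N)%N -> B j k <= C.
  elim: N {JN} => [|N [C HC]].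
    by exists (B 0 k) => j; rewrite leqn0 absz_eq0 => /eqP ->.
  exists (Num.max C (Num.max (B N.+1 k) (B (- N.+1%:Z) k))) => j jN.
  have [/HC h|h] := leqP `|j|%N N; first by rewrite le_max h.
  have [->|->] : j = N.+1 \/ j = - N.+1%:Z by lia.
    by rewrite !le_max lexx orbT.
  by rewrite !le_max lexx !orbT.
have [N' HN'] := H (M * C).
exists (N + `|N'|)%N => // n /= Nn j /JN jN.
apply: (@le_trans _ _ (M * C)); first by rewrite ler_pM2l// HC.
apply: HN'; rewrite mulrDr mulrA ss mul1r.
have : `|(s * j)%R|%N = `|j|%N.
  by rewrite abszM (_ : `|s|%N = 1%N) ?mul1n//; nia.
lia.
Qed.

(** An index j of J far out on the side opposite to s reaches 0 after |j| steps
in direction s, hence B_(j,k) <= B_(0,l); but B_(j,k) tends to infinity on that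
side. *)
Lemma diverges_bounded s J k l : s * s = 1 ->
  diverges s J k l -> escapes (- s) k ->
  exists N : nat, forall j, J j -> - s * j <= N%:Z.
Proof.
move=> ss H E; have [N _ HN] := H 1; have [N' HN'] := E (B 0 l + 1).
exists (N + `|N'|)%N => j Jj; rewrite leNgt; apply/negP => jN.
pose n := `|(- s * j)%R|%N.
have nE : n%:Z = - s * j by rewrite /n; lia.
have := HN n _ j Jj; rewrite /= nE mulrA mulrN ss mulN1r subrr mul1r.
have Nn : (N <= n)%N by rewrite -lez_nat nE; lia.
(* At the index j, the first bound gives B j k <= B 0 l, the second one
   B 0 l + 1 <= B j k. *)
have N'j : N' <= - s * j by lia.
by move=> /(_ Nn); have := HN' j N'j; lra.
Qed.

(** The indices outside J on the side of s move towards the origin, so that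
they are finitely many. *)
Lemma diverges_half s J k l : s * s = 1 -> (k <= l)%N ->
  diverges s J k l -> diverges (- s) (~` J) k l -> escapes s k ->
  diverges s [set j | 0 < s * j] k l.
Proof.
move=> ss kl HJ HJc E.
have [N HN] : exists N : nat, forall j, (~` J) j -> - - s * j <= N%:Z.
  by apply: diverges_bounded HJc _; rewrite ?mulrNN ?opprK.
apply: (@divergesS _ _ (J `|` ([set j | 0 < s * j] `\` J))).
  by move=> j /= sj; have [Jj|Jj] := pselect (J j); [left|right].
apply: divergesU => //; apply: (@diverges_finite _ _ _ _ N) => //; last first.
  exact: escapes_le E.
move=> j /= [sj /HN]; rewrite opprK => sjN.
have : `|(s * j)%R|%N = `|j|%N.
  by rewrite abszM (_ : `|s|%N = 1%N) ?mul1n//; nia.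
lia.
Qed.

Lemma oriented_escapes s : s * s = 1 -> oriented s -> exists l, escapes s l.
Proof.
move=> ss H; have [k B0] := kothe_entry_gt0 B 0; have [l Hl] := H k.
by exists l; exact: escapes_of_diverges B0 Hl.
Qed.

(** By [diverges_bounded], since the set of all indices is unbounded on the side
opposite to s. *)
Lemma oriented_not_escapes s : s * s = 1 ->
  oriented s -> ~ exists k, escapes (- s) k.
Proof.
move=> ss H [k E]; have [l Hl] := H k.
have [N /(_ (- s * N.+1%:Z) I)] := diverges_bounded ss Hl E.
rewrite mulrA mulrNN ss mul1r; lia.
Qed.

Lemma outward_escapes : outward ->
  (exists l, escapes (-1) l) /\ (exists l, escapes 1 l).
Proof.
move=> H; split.
  have [k B0] := kothe_entry_gt0 B (-1); have [l [Hl _]] := H k.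
  by exists l; apply: (escapes_of_diverges _ _ B0 Hl).
have [k B0] := kothe_entry_gt0 B 1; have [l [_ Hl]] := H k.
by exists l; apply: (escapes_of_diverges _ _ B0 Hl).
Qed.

(** An index outside J where B_(.,k) is nonzero would make B escape in the
direction - s. *)
Lemma splits_oriented s : s * s = 1 ->
  (forall k, exists l J, diverges s J k l /\ diverges (- s) (~` J) k l) ->
  ~ (exists l, escapes (- s) l) -> oriented s.
Proof.
move=> ss H E k; have [l [J [HJ HJc]]] := H k; exists l.
apply: (@divergesS _ _ (J `|` ~` J)); first by rewrite setUv.
apply: divergesU => //; apply: diverges_null => j Jj.
apply/eqP; rewrite eq_le kothe_entry_ge0 andbT leNgt; apply/negP => B0.
by apply: E; exists l; apply: escapes_of_diverges B0 HJc; rewrite ?mulrNN.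
Qed.

(** From right to left, (c) leaves out the index 0; it is put on the negative
side, where it behaves as its neighbour -1. From left to right, the three cases
are distinguished by the directions in which B escapes. *)
Lemma splitsP : splits <-> oriented (-1) \/ oriented 1 \/ outward.
Proof.
split=> [H|[H k|[H k|H k]]]; last 3 first.
- have [l Hl] := H k; exists l, setT; split=> //.
  by rewrite setCT; apply: diverges_null.
- have [l Hl] := H k; exists l, set0; split; last by rewrite setC0.
  exact: diverges_null.
- have [k1 B1] := kothe_entry_gt0 B (-1).
  have [l [Hm Hp]] := H (maxn k k1); exists l, [set j | j <= 0]; split.
    apply: (@divergesS _ _ ([set j | j < 0] `|` [set 0])).
      by move=> j /=; rewrite le_eqVlt => /predU1P[->|]; [right|left].
    apply: divergesU; first by apply: diverges_le Hm; rewrite ?leq_maxl.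
    apply: (@diverges_finite _ _ _ _ 0%N) => // [j -> //|].
    apply: (@escapes_of_diverges _ [set j | j < 0] (maxn k k1) _ (-1)) => //.
    by apply: lt_le_trans B1 _; rewrite le_kothe_entry ?leq_maxr.
  apply: (@divergesS _ _ [set j | 0 < j]).
    by move=> j /= /negP; rewrite -ltNge.
  by apply: diverges_le Hp; rewrite ?leq_maxl.
have [[lm Em]|Em] := pselect (exists l, escapes (-1) l); last first.
  right; left; apply: splits_oriented => // k; have [l [J [HJ HJc]]] := H k.
  by exists l, (~` J); rewrite setCK.
have [[lp Ep]|Ep] := pselect (exists l, escapes 1 l); last first.
  by left; apply: splits_oriented => // k; rewrite opprK; exact: H.
right; right => k.
(* k' is so large that B_(.,k') itself escapes in both directions. *)
pose k' := maxn k (maxn lm lp); have [l [J [HJ HJc]]] := H k'.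
have E1 : (k <= k')%N by rewrite leq_maxl.
have E2 : escapes (-1) k' by apply: escapes_le Em; rewrite /k'; lia.
have E3 : escapes 1 k' by apply: escapes_le Ep; rewrite /k'; lia.
exists (maxn l k').
have HJ' : diverges (-1) J k' (maxn l k').
  by apply: diverges_le HJ; rewrite ?leq_maxl.
have HJc' : diverges 1 (~` J) k' (maxn l k').
  by apply: diverges_le HJc; rewrite ?leq_maxl.
split; apply: (@diverges_le _ _ _ k' _ (maxn l k')) => //.
  apply: (@divergesS _ _ [set j | 0 < -1 * j]); first by move=> j /=; lia.
  by apply: (diverges_half _ _ HJ') => //; rewrite ?opprK ?leq_maxr.
apply: (@divergesS _ _ [set j | 0 < 1 * j]); first by move=> j /=; lia.
by apply: (diverges_half _ _ HJc') => //; rewrite ?setCK ?leq_maxr.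
Qed.

End Growth.
(** * Translates and single terms in the sequence norms *)

Section SequenceNormFacts.
Local Open Scope classical_set_scope.
Context (R : realType).
Implicit Types (p : exponent R) (u v : int -> R).

Lemma seq_finite_shift p u (m : int) :
  seq_finite p u -> seq_finite p (fun j => u (j + m)).
Proof.
case: p => [|p p1] /=.
  move=> H e /H[N HN]; exists (N + `|m|)%N => j jN; apply: HN; lia.
rewrite (@reindex_esum _ _ _ [set: int] _ (fun j => j + m))//.
split=> // [a b _ _ /addIr //|j _]; by exists (j - m) => //; rewrite subrK.
Qed.

Lemma seq_norm_shift p u (m : int) :
  seq_norm p (fun j => u (j + m)) = seq_norm p u.
Proof.
case: p => [|p p1] /=.
  congr sup; apply/seteqP; split=> _ [j _ <-]; first by exists (j + m).
  by exists (j - m) => //; rewrite subrK.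
rewrite [in RHS](@reindex_esum _ _ _ [set: int] _ (fun j => j + m))//.
split=> // [a b _ _ /addIr //|j _]; by exists (j - m) => //; rewrite subrK.
Qed.

Lemma seq_single p (c : R) (i : int) : 0 <= c ->
  seq_finite p (fun j => if j == i then c else 0) /\
  seq_norm p (fun j => if j == i then c else 0) = c.
Proof.
move=> c0; case: p => [|p p1].
  split=> /=.
    move=> e e0; exists `|i|%N.+1 => j; case: eqP => [->|//]; lia.
  apply/eqP; rewrite eq_le; apply/andP; split.
    apply: ge_sup; first by exists c, i; rewrite ?eqxx.
    by move=> _ [j _ <-]; case: ifP.
  apply: ub_le_sup; last by exists i; rewrite ?eqxx.
  by exists c => _ [j _ <-]; case: ifP.
have p0 : 0 < p by rewrite (lt_le_trans _ p1).
have E : (\esum_(j in [set: int]) ((if j == i then c else 0) `^ p)%:E)%E =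
    (c `^ p)%:E.
  rewrite -(@esum_set1 _ _ i (fun=> (c `^ p)%:E)) ?lee_fin ?powR_ge0//.
  rewrite [in RHS]esum_mkcond; apply: eq_esum => j _;
  have [->|ji] := eqVneq j i; first by rewrite mem_set.
  by rewrite memNset ?powR0 ?gt_eqF// => /eqP; rewrite (negPf ji).
by rewrite /= E ltry -powRrM mulfV ?gt_eqF// powRr1.
Qed.

End SequenceNormFacts.

(** * Removing the weights from the shift *)

Section Rescaling.
Local Open Scope classical_set_scope.
Context (R : realType) (F : scalar_kind).
Variables (A : kothe_matrix R) (w : int -> base_field R F).
Hypothesis w_neq0 : forall j, w j != 0.

Lemma modulus_gt0 (z : base_field R F) : z != 0 -> 0 < modulus z.
Proof.
move=> z0; rewrite lt_neqAle modulus_ge0 andbT eq_sym; apply/eqP => mz.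
by have /eqP := modulusM z z^-1; rewrite mulfV// modulus1 mz mul0r oner_eq0.
Qed.

(** The solution of [scale_step] with value 1 at 0. *)
Definition scale (j : int) : R :=
  match j with
  | Posz n => \prod_(i < n) (modulus (w i.+1%:Z))^-1
  | Negz n => \prod_(i < n.+1) modulus (w (- i%:Z))
  end.

Lemma scale_gt0 j : 0 < scale j.
Proof.
by case: j => n; apply: prodr_gt0 => i _; rewrite ?invr_gt0 modulus_gt0.
Qed.

Lemma scale_step j : scale j = scale (j + 1) * modulus (w (j + 1)).
Proof.
case: j => [n|[|n]].
- have -> : Posz n + 1 = n.+1%:Z by lia.
  by rewrite /= big_ord_recr/= divfK ?gt_eqF ?modulus_gt0.
- by rewrite /= big_ord_recl !big_ord0 mulr1 mul1r.
have -> : Negz n.+1 + 1 = Negz n by lia.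
by rewrite /= big_ord_recr/=; congr (_ * modulus (w _)); lia.
Qed.

Lemma modulus_prod j n :
  modulus (\prod_(1 <= i < n.+1) w (j + i%:Z)) = scale j / scale (j + n%:Z).
Proof.
elim: n => [|n IH].
  by rewrite big_nil modulus1 addr0 divff// gt_eqF ?scale_gt0.
rewrite big_nat_recr//= modulusM IH (scale_step (j + n)).
have -> : j + n.+1%:Z = j + n%:Z + 1 by lia.
by rewrite invfM mulrA divfK ?gt_eqF ?modulus_gt0.
Qed.

Fact rescaled_entry_ge0 j k : 0 <= scale j * A j k.
Proof. by rewrite mulr_ge0 ?kothe_entry_ge0// ltW ?scale_gt0. Qed.

Fact rescaled_entry_nondecreasing j k :
  scale j * A j k <= scale j * A j k.+1.
Proof. by rewrite ler_wpM2l ?kothe_entry_nondecreasing// ltW ?scale_gt0. Qed.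

Fact rescaled_entry_gt0 j : exists k, 0 < scale j * A j k.
Proof.
by have [k Ak] := kothe_entry_gt0 A j; exists k; rewrite mulr_gt0 ?scale_gt0.
Qed.

Definition rescaled : kothe_matrix R :=
  KotheMatrix rescaled_entry_ge0 rescaled_entry_nondecreasing
    rescaled_entry_gt0.

Lemma backward_ratioE k l n j :
  backward_ratio A w k l n j = rescaled (j + -1 * n%:Z) l / rescaled j k.
Proof.
rewrite /backward_ratio modulus_prod subrK mulN1r /=.
by rewrite invfM !mulrA [A _ _ * _]mulrC.
Qed.

Lemma forward_ratioE k l n j :
  forward_ratio A w k l n j = rescaled (j + 1 * n%:Z) l / rescaled j k.
Proof.
rewrite /forward_ratio modulus_prod mul1r /= !invfM invrK.
by rewrite [LHS]mulrC; ring.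
Qed.

Lemma inf_divergesP (I : set int) (r : nat -> int -> R) :
  inf_diverges I r <->
  forall M, \forall n \near \oo, forall j, I j -> M <= r n j.
Proof.
rewrite /inf_diverges cvgeyPge; split=> H M; apply: filterS (H M) => n Hn.
  move=> j Ij; rewrite -lee_fin; apply: le_trans Hn _.
  by apply: ereal_inf_lbound; exists j.
by apply: le_ereal_inf_tmp => _ [j Ij <-]; rewrite lee_fin; exact: Hn.
Qed.

Lemma inf_diverges_diverges s (J : set int) k l (r : nat -> int -> R) :
  (forall n j, r n j = rescaled (j + s * n%:Z) l / rescaled j k) ->
  inf_diverges (kothe_support A k `&` J) r <-> diverges rescaled s J k l.
Proof.
move=> rE; rewrite inf_divergesP.
split=> H M; apply: filterS (H M) => n Hn j.
  move=> Jj; have [A0|A0] := eqVneq (A j k) 0.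
    by rewrite /= A0 !mulr0 rescaled_entry_ge0.
  have B0 : 0 < rescaled j k.
    by rewrite /= mulr_gt0 ?scale_gt0// lt_neqAle eq_sym A0 kothe_entry_ge0.
  by have := Hn j (conj A0 Jj); rewrite rE ler_pdivlMr.
move=> [A0 /Hn]; rewrite rE ler_pdivlMr//.
by rewrite /= mulr_gt0 ?scale_gt0// lt_neqAle eq_sym A0 kothe_entry_ge0.
Qed.

Lemma backward_conditionP : backward_condition A w <-> oriented rescaled (-1).
Proof.
split=> H k; have [l Hl] := H k; exists l.
  by apply/(inf_diverges_diverges _ (backward_ratioE k l)); rewrite setIT.
rewrite -[kothe_support _ _]setIT.
exact/(inf_diverges_diverges _ (backward_ratioE k l)).
Qed.

Lemma forward_conditionP : forward_condition A w <-> oriented rescaled 1.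
Proof.
split=> H k; have [l Hl] := H k; exists l.
  by apply/(inf_diverges_diverges _ (forward_ratioE k l)); rewrite setIT.
rewrite -[kothe_support _ _]setIT.
exact/(inf_diverges_diverges _ (forward_ratioE k l)).
Qed.

Lemma split_conditionP : split_condition A w <-> outward rescaled.
Proof.
split=> H k; have [l [Hm Hp]] := H k; exists l; split.
- exact/(inf_diverges_diverges _ (backward_ratioE k l)).
- exact/(inf_diverges_diverges _ (forward_ratioE k l)).
- exact/(inf_diverges_diverges _ (backward_ratioE k l)).
- exact/(inf_diverges_diverges _ (forward_ratioE k l)).
Qed.

End Rescaling.
(** * Expansivity read off on the indices *)

Lemma half_le_summand (R : realType) (a b : R) :
  1 <= a + b -> 1 / 2 <= a \/ 1 / 2 <= b.
Proof. by move=> ab; have [h|h] := leP (1 / 2) a; [left|right; lra]. Qed.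

Section Dynamics.
Local Open Scope classical_set_scope.
Context (R : realType) (F : scalar_kind) (p : exponent R) (A : kothe_matrix R).
Variable w : int -> base_field R F.
Hypothesis w_neq0 : forall j, w j != 0.

Local Notation X := (kothe_space F p A).
Local Notation q := (@kothe_seminorm R F p A).
Local Notation B := (rescaled A w_neq0).
Implicit Types (x : X) (s : int) (S : X -> X) (J : set int) (k l : nat).

(** S moves the rescaled moduli |x_j| / c_j by s: B_w does so for s = -1 and its
inverse for s = 1. *)
Definition translates s S : Prop := forall x j,
  modulus (S x j) / scale w j = modulus (x (j - s)) / scale w (j - s).

Lemma translates_iter s S n x j : translates s S ->
  modulus (iter n S x j) / scale w j =
  modulus (x (j - s * n%:Z)) / scale w (j - s * n%:Z).
Proof.
move=> HS; elim: n j => [|n IH] j; first by rewrite mulr0 subr0.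
rewrite iterS HS IH; have -> // : j - s - s * n%:Z = j - s * n.+1%:Z by lia.
Qed.

Lemma kothe_seq_finite k x : seq_finite p (fun j => A j k * modulus (x j)).
Proof. by case: x => x /= /asboolP. Qed.

(** Reading the seminorm of the n-th iterate at j + s n instead of j leaves the
coordinates of x in place and moves the matrix, which makes it comparable,
index by index, with a seminorm of x. *)
Lemma orbit_seminorm s S n x l : translates s S ->
  seq_finite p (fun j => B (j + s * n%:Z) l * (modulus (x j) / scale w j)) /\
  q l (iter n S x) =
  seq_norm p (fun j => B (j + s * n%:Z) l * (modulus (x j) / scale w j)).
Proof.
move=> HS; have := kothe_seq_finite l (iter n S x); rewrite /kothe_seminorm.
set u := fun j : int => A j l * _ => fin.
have -> : (fun j => B (j + s * n%:Z) l * (modulus (x j) / scale w j)) =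
    (fun j => u (j + s * n%:Z)).
  apply/funext => j; rewrite /u /=.
  have := translates_iter n x (j + s * n%:Z) HS; rewrite addrK => <-.
  by field; rewrite gt_eqF ?scale_gt0.
by split; [exact: seq_finite_shift|rewrite seq_norm_shift].
Qed.

Definition part_seminorm J k x : R :=
  seq_norm p (fun j => if j \in J then A j k * modulus (x j) else 0).

Lemma part_seminorm_finite J k x :
  seq_finite p (fun j => if j \in J then A j k * modulus (x j) else 0).
Proof.
have x0 j : 0 <= A j k * modulus (x j).
  by rewrite mulr_ge0 ?kothe_entry_ge0 ?modulus_ge0.
by apply: (le_seq_norm _ _ (kothe_seq_finite k x)).1 => j; case: ifP.
Qed.

Lemma part_seminormT k x : part_seminorm setT k x = q k x.
Proof.
by congr (seq_norm p _); apply/funext => j; rewrite mem_set.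
Qed.

Lemma le_part_seminormC J k x :
  q k x <= part_seminorm J k x + part_seminorm (~` J) k x.
Proof.
pose f I j := if j \in (I : set int) then A j k * modulus (x j) else 0.
have f0 I j : 0 <= f I j.
  rewrite /f; case: ifP => // _.
  by rewrite mulr_ge0 ?kothe_entry_ge0 ?modulus_ge0.
have [_ le2] := seq_normD (f0 J) (f0 (~` J)) (part_seminorm_finite J k x)
  (part_seminorm_finite (~` J) k x).
apply: le_trans le2; rewrite le_eqVlt; apply/orP; left; apply/eqP.
rewrite /kothe_seminorm; congr (seq_norm p _); apply/funext => j.
by rewrite /f in_setC; case: ifP; rewrite ?addr0 ?add0r.
Qed.

(** Termwise comparison of the two sequences, thanks to [orbit_seminorm]. *)
Lemma part_seminorm_expands s S J k l n M x : translates s S -> 0 < M ->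
  (forall j, J j -> M * B j k <= B (j + s * n%:Z) l) ->
  M * part_seminorm J k x <= q l (iter n S x).
Proof.
move=> HS M0 H; have [fin ->] := orbit_seminorm n x l HS.
set v := fun j : int => _ in fin *.
have v0 j : 0 <= v j.
  by rewrite mulr_ge0 ?kothe_entry_ge0// divr_ge0 ?modulus_ge0// ltW ?scale_gt0.
have Mi0 : 0 <= M^-1 by rewrite invr_ge0 ltW.
have [fin' le'] := seq_normZ Mi0 v0 fin.
rewrite -(ler_pdivlMl _ _ M0); apply: le_trans le'.
apply: (le_seq_norm _ _ fin').2 => j.
  by case: ifP => // _; rewrite mulr_ge0 ?kothe_entry_ge0 ?modulus_ge0.
case: ifP => [/set_mem Jj|_]; last by rewrite mulr_ge0.
rewrite ler_pdivlMl// /v.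
have -> : M * (A j k * modulus (x j)) =
    (M * B j k) * (modulus (x j) / scale w j).
  by rewrite /=; field; rewrite gt_eqF ?scale_gt0.
by rewrite ler_wpM2r ?H// divr_ge0 ?modulus_ge0// ltW ?scale_gt0.
Qed.

Lemma diverges_uniformly_of_diverges s S J k l (D : set X) :
  translates s S -> diverges B s J k l ->
  (forall x, D x -> 1 / 2 <= part_seminorm J k x) ->
  diverges_uniformly_on D (fun n x => q l (iter n S x)).
Proof.
move=> HS H HD M; have M0 : 0 < 2 * Num.max 1 M.
  by rewrite mulr_gt0// lt_max ltr01.
apply: filterS (H (2 * Num.max 1 M)) => n Hn x /HD Dx.
apply: le_trans (part_seminorm_expands x HS M0 Hn).
apply: (@le_trans _ _ (2 * Num.max 1 M * (1 / 2))).
  by rewrite mulrC mulrA divfK// ?mul1r ?le_max ?lexx ?orbT.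
by rewrite ler_wpM2l// ltW.
Qed.

Definition real_scalar (r : R) : base_field R F :=
  match F with RealScalars => r | ComplexScalars => r%:C%C end.

Lemma modulus_real_scalar r : 0 <= r -> modulus (real_scalar r) = r.
Proof.
rewrite /real_scalar; case: F => r0 /=; first by rewrite ger0_norm.
by rewrite expr0n/= addr0 sqrtr_sqr ger0_norm.
Qed.

(** The j-th basis vector, normalized for the k-th seminorm; it is null when
A j k = 0. *)
Definition unit_seq k j : int -> (base_field R F)^o :=
  fun i => if i == j then real_scalar (A j k)^-1 else 0.

Lemma modulus_unit_seq k j i :
  modulus (unit_seq k j i) = if i == j then (A j k)^-1 else 0.
Proof.
rewrite /unit_seq; case: ifP => _; last exact: modulus0.
by rewrite modulus_real_scalar ?invr_ge0 ?kothe_entry_ge0.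
Qed.

Lemma unit_seq_in k j : unit_seq k j \in kothe_pred p A.
Proof.
apply/asboolP => l.
have -> : (fun i => A i l * modulus (unit_seq k j i)) =
    (fun i => if i == j then A j l * (A j k)^-1 else 0).
  apply/funext => i; rewrite modulus_unit_seq.
  by case: eqP => [->|]; rewrite ?mulr0.
by apply: (seq_single _ _ _).1; rewrite mulr_ge0 ?invr_ge0 ?kothe_entry_ge0.
Qed.

Definition unit_vector k j : X := Kothe (unit_seq_in k j).

Lemma unit_vector_orbit s S k l n j : translates s S ->
  q l (iter n S (unit_vector k j)) = B (j + s * n%:Z) l / B j k.
Proof.
move=> HS; rewrite (orbit_seminorm _ _ _ HS).2.
rewrite -[RHS](seq_single p j _).2; last by rewrite divr_ge0 ?kothe_entry_ge0.
congr (seq_norm p _); apply/funext => i /=; rewrite modulus_unit_seq.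
case: eqP => [->|_]; last by rewrite mul0r mulr0.
by rewrite invfM [X in _ * X]mulrC.
Qed.

(** The norm of the unit vector is the case n = 0 of [unit_vector_orbit]. *)
Lemma unit_vector_sphere k j : A j k != 0 -> unit_sphere q k (unit_vector k j).
Proof.
move=> A0; have id_tr : translates 0 (@id X) by move=> x i; rewrite subr0.
rewrite /unit_sphere /= (unit_vector_orbit k k 0 j id_tr) mulr0 addr0 divff//=.
by rewrite mulf_neq0// gt_eqF ?scale_gt0.
Qed.

Lemma diverges_of_diverges_uniformly s S J k l (D : set X) :
  translates s S ->
  (forall j, J j -> A j k != 0 -> D (unit_vector k j)) ->
  diverges_uniformly_on D (fun n x => q l (iter n S x)) -> diverges B s J k l.
Proof.
move=> HS HD H M; apply: filterS (H M) => n Hn j /HD Dj.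
have [A0|A0] := eqVneq (A j k) 0.
  by rewrite /= A0 !mulr0 rescaled_entry_ge0.
have B0 : 0 < B j k.
  by rewrite /= mulr_gt0 ?scale_gt0// lt_neqAle eq_sym A0 kothe_entry_ge0.
by have := Hn _ (Dj A0); rewrite (unit_vector_orbit _ _ _ _ HS) ler_pdivlMr.
Qed.

Variable Bw : GL X.
Hypothesis Bw_shift : forall x,
  kothe_seq (Bw x) = weighted_backward_shift w (kothe_seq x).

Lemma translates_shift : translates (-1) Bw.
Proof.
move=> x j; rewrite Bw_shift /weighted_backward_shift opprK modulusM.
rewrite (scale_step w_neq0 j); field.
by rewrite !gt_eqF ?scale_gt0 ?modulus_gt0.
Qed.

Lemma translates_shift_inv : translates 1 (GL_inv Bw).
Proof.
move=> x j; rewrite -[in RHS](GL_invK Bw x) translates_shift.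
by rewrite opprK subrK.
Qed.

Lemma uniformly_positively_expansiveP :
  uniformly_positively_expansive q Bw <-> oriented B (-1).
Proof.
split=> H k; have [l Hl] := H k; exists l.
  apply: diverges_of_diverges_uniformly translates_shift _ Hl.
  by move=> j _; exact: unit_vector_sphere.
apply: diverges_uniformly_of_diverges translates_shift Hl _ => x.
by rewrite part_seminormT => ->; lra.
Qed.

(** Given a covering of the unit sphere, J consists of the indices whose unit
vector lies in the first piece. Given J, the two pieces consist of the points
carrying at least half of their seminorm on J, respectively off J. *)
Lemma uniformly_expansiveP : uniformly_expansive q Bw <-> splits B.
Proof.
split=> H k; have [l] := H k.
  move=> [Sp [Sm [cover Hp Hm]]].
  exists l, [set j | Sp (unit_vector k j)]; split.
    exact: diverges_of_diverges_uniformly translates_shift _ Hp.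
  apply: diverges_of_diverges_uniformly translates_shift_inv _ Hm.
  by move=> j nSp /unit_vector_sphere; rewrite cover => -[].
move=> [J [Hm Hp]]; exists l.
exists (unit_sphere q k `&` [set x | 1 / 2 <= part_seminorm J k x]).
exists (unit_sphere q k `&` [set x | 1 / 2 <= part_seminorm (~` J) k x]).
split.
- rewrite -setIUr; apply/seteqP; split=> [x qx|x []//]; split=> //=.
  have := le_part_seminormC J k x; rewrite (qx : q k x = 1).
  exact: half_le_summand.
- by apply: diverges_uniformly_of_diverges translates_shift Hm _ => x [].
by apply: diverges_uniformly_of_diverges translates_shift_inv Hp _ => x [].
Qed.

End Dynamics.

Theorem mainTheorem7 (R : realType) (F : scalar_kind) (p : exponent R)
    (A : kothe_matrix R) (w : int -> base_field R F) (w_neq0 : forall j, w j != 0)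
    (Bw : GL (kothe_space F p A))
    (Bw_shift : forall x : kothe_space F p A,
      kothe_seq (Bw x) = weighted_backward_shift w (kothe_seq x)) :
  let q := @kothe_seminorm R F p A in
  [/\ uniformly_expansive q Bw <->
        backward_condition A w \/ forward_condition A w \/ split_condition A w,
      ~ (backward_condition A w /\ forward_condition A w),
      ~ (backward_condition A w /\ split_condition A w),
      ~ (forward_condition A w /\ split_condition A w) &
      uniformly_positively_expansive q Bw <-> backward_condition A w].
Proof.
move=> q.
have aP := backward_conditionP A w_neq0; have bP := forward_conditionP A w_neq0.
have cP := split_conditionP A w_neq0.
split.
- apply: (iff_trans (uniformly_expansiveP w_neq0 Bw_shift)).
  apply: (iff_trans (splitsP _)).
  split=> [[/aP|[/bP|/cP]]|[/aP|[/bP|/cP]]]; by [left|right; left|right; right].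
- move=> [/aP Hm /bP Hp]; apply: (oriented_not_escapes _ Hp) => //.
  exact: oriented_escapes Hm.
- move=> [/aP Hm /cP/outward_escapes[_ Ep]].
  by apply: (oriented_not_escapes _ Hm) => //; rewrite opprK.
- move=> [/bP Hp /cP/outward_escapes[Em _]].
  exact: (oriented_not_escapes _ Hp).
- exact: iff_trans (uniformly_positively_expansiveP w_neq0 Bw_shift)
    (iff_sym aP).
Qed.
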